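(* Let $A,B\in\mathbb{R}^{n\times n}$ with $A-B$ nonsingular, let $c\in\mathbb{R}^n$, and suppose that $w^*=(u^*,v^* )\in C_1\cap C_2$ is such that $(u_i^*,v_i^* )\ne(0,0)$ for all $i=1,\dots,n$. If $Q:=(A^{\mathsf T}+B^{\mathsf T})(A^{\mathsf T}-B^{\mathsf T})^{-1}$ is nondegenerate, then there exists sufficiently small $\delta>0$ such that for any $w^0\in\mathbb{R}^n\times\mathbb{R}^n$ with $\|w^0-w^*\|<\delta$, the sequence $\{w^k\}_{k=0}^\infty$ generated by $w^{k+1}\in(P_{C_1}\circ P_{C_2})(w^k)$, $k\ge0$, converges linearly to $w^*$.
   Context: A square matrix is nondegenerate if all its principal minors are nonzero. With $T=[\,A+B\;\;\;-A+B\,]\in\mathbb{R}^{n\times 2n}$, $C_1:=\{w\in\mathbb{R}^n\times\mathbb{R}^n: Tw=\sqrt2\,c\}$ and $C_2:=\{w=(u,v)\in\mathbb{R}^n\times\mathbb{R}^n: u\ge 0,\ v\ge 0,\ \langle u,v\rangle=0\}$ (inequalities componentwise). For a set $S$, $P_S(z):=\{s\in S:\|s-z\|\le\|t-z\|\ \forall t\in S\}$ is the (possibly multivalued) Euclidean metric projector, and $(P_{C_1}\circ P_{C_2})(w)=\bigcup_{w'\in P_{C_2}(w)}P_{C_1}(w')$. *)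

(* Defs.v *)
From mathcomp Require Import all_boot all_order all_algebra.
From mathcomp Require Import all_classical all_reals all_analysis.

Set Implicit Arguments.
Unset Strict Implicit.
Unset Printing Implicit Defensive.

Import Order.TTheory GRing.Theory Num.Theory.
Import numFieldNormedType.Exports.

Local Open Scope classical_set_scope.
Local Open Scope ring_scope.

(* R^n x R^n is encoded as 'cV[R]_(n + n): the pair (u, v) is col_mx u v, with
   components usubmx w and dsubmx w. *)

(* The library norm on matrices is the sup norm, hence this definition. *)
Definition enorm (R : realType) (m : nat) (x : 'cV[R]_m) : R :=
  Num.sqrt (\sum_(i < m) x i 0 ^+ 2).

Definition inner_prod (R : realType) (m : nat) (x y : 'cV[R]_m) : R :=
  \sum_(i < m) x i 0 * y i 0.

Definition nondegenerate_mx (R : realType) (n : nat) (M : 'M[R]_n) : Prop :=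
  forall I : {set 'I_n}, I != finset.set0 ->
    \det (mxsub (fun i : 'I_#|I| => enum_val i)
                (fun i : 'I_#|I| => enum_val i) M) != 0.

Definition T_mx (R : realType) (n : nat) (A B : 'M[R]_n) : 'M[R]_(n, n + n) :=
  row_mx (A + B) (- A + B).

Definition C1 (R : realType) (n : nat) (A B : 'M[R]_n) (c : 'cV[R]_n) :
    set 'cV[R]_(n + n) :=
  [set w | T_mx A B *m w = Num.sqrt 2 *: c].

Definition C2 (R : realType) (n : nat) : set 'cV[R]_(n + n) :=
  [set w | [/\ forall i, 0 <= usubmx w i 0,
               forall i, 0 <= dsubmx w i 0
             & inner_prod (usubmx w) (dsubmx w) = 0]].
Arguments C2 : clear implicits.

Definition metric_proj (R : realType) (m : nat) (S : set 'cV[R]_m)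
    (z : 'cV[R]_m) : set 'cV[R]_m :=
  [set s | S s /\ forall t, S t -> enorm (s - z) <= enorm (t - z)].

Definition alt_proj (R : realType) (m : nat) (S1 S2 : set 'cV[R]_m)
    (w : 'cV[R]_m) : set 'cV[R]_m :=
  \bigcup_(w' in metric_proj S2 w) metric_proj S1 w'.

(* Q-linear convergence in the Euclidean norm, with the rate valid from the
   first term on. *)
Definition converges_linearly (R : realType) (m : nat) (w : nat -> 'cV[R]_m)
    (l : 'cV[R]_m) : Prop :=
  w @ \oo --> l /\
  exists rho : R, 0 < rho < 1 /\
    forall k, enorm (w k.+1 - l) <= rho * enorm (w k - l).

(* Main.v *)
Require Import Defs.
From mathcomp Require Import all_boot all_order all_algebra.
From mathcomp Require Import all_classical all_reals all_analysis.
From mathcomp Require Import ring lra.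
Set Implicit Arguments.
Unset Strict Implicit.
Unset Printing Implicit Defensive.

Import Order.TTheory GRing.Theory Num.Theory.
Import numFieldNormedType.Exports.
Local Open Scope classical_set_scope.
Local Open Scope ring_scope.

(** Near the strictly complementary point l = w*, the nonconvex set C2
    coincides with a coordinate subspace: let I be the set of indices with
    u*_i > 0.  A point of C2 close to l has positive u_i for i in I and
    positive v_i elsewhere, so by complementarity its other components vanish:
    it lies in the subspace [face I].  On that subspace C2 is convex, hence
    the projection s on C2 of a nearby point x satisfies |s - l| <= |x - l|.

    The second projection y, on the affine space C1, gives a genuine gain.
    By the obtuse angle inequality, |y - l|^2 + |y - s|^2 <= |s - l|^2, so it
    is enough to bound |s - l| by a multiple of |y - s|.  As T y = T l, the
    vectors T (s - l) and T (s - y) agree, and it suffices that T have a left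
    inverse on [face I].  This is where nondegeneracy enters: up to the
    invertible factor A - B, T (u, v) is Q^T u - v, and if this is 0 with u
    supported on I and v outside of I, then the principal block of Q on I
    kills u, so that u = 0 and v = 0.  If |s - l|^2 <= K |y - s|^2, the
    composite projection contracts the distance to l by a factor
    sqrt (1 - 1 / (K + 2)) as long as it starts in a small ball around l;
    the iterates never leave this ball, and linear convergence follows.  The
    carrying lemmas are [face_left_inverse], [C2_near_face],
    [metric_proj_obtuse] and [alt_proj_contraction]. *)

(** * Euclidean norm and inner product *)

Lemma inner_prod_ge0 (R : realType) (m : nat) (x : 'cV[R]_m) :
  0 <= inner_prod x x.
Proof. by apply: sumr_ge0 => i _; rewrite -expr2 sqr_ge0. Qed.

Lemma enorm_ge0 (R : realType) (m : nat) (x : 'cV[R]_m) : 0 <= enorm x.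
Proof. exact: sqrtr_ge0. Qed.

Lemma sqr_enorm (R : realType) (m : nat) (x : 'cV[R]_m) :
  enorm x ^+ 2 = inner_prod x x.
Proof.
rewrite /enorm /inner_prod sqr_sqrtr.
  by apply: eq_bigr => i _; rewrite expr2.
by apply: sumr_ge0 => i _; exact: sqr_ge0.
Qed.

Lemma ler_enorm (R : realType) (m : nat) (x y : 'cV[R]_m) :
  (enorm x <= enorm y) = (inner_prod x x <= inner_prod y y).
Proof. by rewrite -!sqr_enorm ler_sqr // nnegrE enorm_ge0. Qed.

Lemma ler_entry_enorm (R : realType) (m : nat) (x : 'cV[R]_m) (i : 'I_m) :
  `|x i 0| <= enorm x.
Proof.
rewrite -sqrtr_sqr ler_sqrt (bigD1 i) //=; last first.
  by rewrite addr_ge0 ?sqr_ge0 // sumr_ge0 // => j _; exact: sqr_ge0.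
by rewrite lerDl sumr_ge0 // => j _; exact: sqr_ge0.
Qed.

(** Links the topology of the matrix space, which comes from the sup norm,
    with the Euclidean norm. *)
Lemma ler_norm_enorm (R : realType) (m : nat) (x : 'cV[R]_m) :
  `|x| <= enorm x.
Proof.
rewrite [`|x|]mx_normrE; apply: bigmax_le => [|[i j] _]; first exact: enorm_ge0.
by rewrite /= ord1; exact: ler_entry_enorm.
Qed.

Lemma inner_prodDZ (R : realType) (m : nat) (x y : 'cV[R]_m) (t : R) :
  inner_prod (x + t *: y) (x + t *: y) =
  inner_prod x x + 2 * t * inner_prod x y + t ^+ 2 * inner_prod y y.
Proof.
rewrite /inner_prod !mulr_sumr -!big_split /=; apply: eq_bigr => i _.
by rewrite !mxE; ring.
Qed.

Lemma inner_prodN (R : realType) (m : nat) (x : 'cV[R]_m) :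
  inner_prod (- x) (- x) = inner_prod x x.
Proof. by apply: eq_bigr => i _; rewrite !mxE mulrNN. Qed.

(** Each entry of [M *m x] is at most the l1 norm of a row of [M] times the
    Euclidean norm of [x]; this crude bound avoids Cauchy-Schwarz. *)
Lemma mulmx_bounded (R : realType) (m p : nat) (M : 'M[R]_(m, p)) :
  exists K : R, 0 <= K /\ forall x : 'cV[R]_p,
    inner_prod (M *m x) (M *m x) <= K * inner_prod x x.
Proof.
pose r i := \sum_j `|M i j|.
exists (\sum_i r i ^+ 2); split.
  by apply: sumr_ge0 => i _; exact: sqr_ge0.
move=> x; rewrite /inner_prod mulr_suml; apply: ler_sum => i _.
rewrite -[X in _ <= _ * X]/(inner_prod x x) -sqr_enorm -exprMn -expr2.
rewrite -ler_sqrt ?sqr_ge0 // !sqrtr_sqr.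
have r0 : 0 <= r i by apply: sumr_ge0.
rewrite [X in _ <= X]ger0_norm ?mulr_ge0 ?enorm_ge0 //.
rewrite mxE (le_trans (ler_norm_sum _ _ _)) // mulr_suml; apply: ler_sum => j _.
by rewrite normrM ler_wpM2l // ler_entry_enorm.
Qed.

(** * Metric projections *)

(** The obtuse angle property of projections.  The set [S] is only asked to
    contain the segment from the projection [s] to the reference point [l], so
    that the same inequality serves for the affine space C1 and for the
    nonconvex set C2. *)
Lemma metric_proj_obtuse (R : realType) (m : nat) (S : set 'cV[R]_m)
    (z s l : 'cV[R]_m) :
  metric_proj S z s ->
  (forall t : R, 0 <= t <= 1 -> S (s + t *: (l - s))) ->
  inner_prod (s - l) (s - l) + inner_prod (s - z) (s - z) <=
  inner_prod (z - l) (z - l).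
Proof.
move=> [_ smin] seg; set a := s - z; set d := l - s.
have -> : s - l = - d by rewrite /d opprB.
have -> : z - l = - (a + 1 *: d).
  by apply/matrixP => i j; rewrite /a /d !mxE; ring.
rewrite !inner_prodN inner_prodDZ expr1n !mul1r mulr1.
suff : 0 <= inner_prod a d by lra.
rewrite leNgt; apply/negP => ad_lt0.
have q_ge0 := inner_prod_ge0 d.
set b := inner_prod a d in ad_lt0 *; set q := inner_prod d d in q_ge0 *.
have qb : 0 < q - b by lra.
(* On the segment, the squared distance to [z] is |a|^2 + 2 b t + q t^2 with
   b < 0; a decrease shows at this t, which lies in [0, 1] and makes sense
   even when q = 0. *)
pose t := - b / (q - b).
have tE : t * (q - b) = - b by rewrite /t divfK // gt_eqF.
have t0 : 0 < t by rewrite divr_gt0 // oppr_gt0.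
have t1 : t <= 1 by rewrite ler_pdivrMr // mul1r; lra.
have t01 : 0 <= t <= 1 by rewrite ltW.
have := smin _ (seg _ t01).
have -> : s + t *: (l - s) - z = a + t *: d by rewrite /a addrAC.
rewrite ler_enorm inner_prodDZ -/b -/q.
by nra.
Qed.

(** * The matrix T on a coordinate subspace *)

Definition face (R : realType) (n : nat) (I : {set 'I_n}) :
    set 'cV[R]_(n + n) :=
  [set w | forall i, if i \in I then dsubmx w i 0 = 0 else usubmx w i 0 = 0].

(** Up to a permutation of the indices, this is block triangular, with the
    principal block of [Q] on [I] and minus the identity on the diagonal: a
    left kernel vector [y] vanishes on [I] because of the first block, and
    the remaining columns then give [y 0 j = 0]. *)
Lemma nondegenerate_row_free (R : realType) (n : nat) (Q : 'M[R]_n)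
    (I : {set 'I_n}) : nondegenerate_mx Q ->
  row_free (diag_mx (\row_i (i \in I)%:R) *m Q -
            diag_mx (\row_i (i \notin I)%:R)).
Proof.
move=> hQ; apply: inj_row_free => y.
rewrite mulmxBr mulmxA => /eqP; rewrite subr_eq0 => /eqP yE.
have entry j : \sum_(i in I) y 0 i * Q i j = y 0 j * (j \notin I)%:R.
  move/(congr1 (fun r : 'rV_n => r 0 j)): yE.
  rewrite !mul_mx_diag !mxE => <-; rewrite big_mkcond; apply: eq_bigr => i _.
  by rewrite !mxE; case: (i \in I); rewrite ?mulr1 ?mulr0 ?mul0r.
have yI i : i \in I -> y 0 i = 0.
  move=> iI; have I0 : I != finset.set0 by apply/set0Pn; exists i.
  have := hQ _ I0; set QI := mxsub _ _ _ => detQ.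
  pose v := \row_(k < #|I|) y 0 (enum_val k).
  have : v *m QI = 0.
    apply/rowP => k; rewrite !mxE.
    transitivity (\sum_(i in I) y 0 i * Q i (enum_val k)).
      rewrite [RHS]big_enum_val; apply: eq_bigr => h _; by rewrite !mxE.
    by rewrite entry (enum_valP k) mulr0.
  have QIu : QI \in unitmx by rewrite unitmxE unitfE.
  move/(congr1 (fun x => x *m invmx QI)); rewrite mulmxK // mul0mx.
  move/rowP/(_ (enum_rank_in iI i)); rewrite !mxE enum_rankK_in //.
apply/rowP => j; rewrite mxE.
have [/yI //|jI] := boolP (j \in I).
have := entry j; rewrite jI mulr1 => <-.
by rewrite big1 // => i iI; rewrite yI // mul0r.
Qed.

(** For [w = (u, v)] in the subspace, the single vector [y = u + v] encodes
    [w], because [u] and [v] are its restrictions to [I] and to the complement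
    of [I].  In terms of [y], [T] is the product of [A - B] and the transpose
    of the matrix of [nondegenerate_row_free], both of which are invertible. *)
Lemma face_left_inverse (R : realType) (n : nat) (A B : 'M[R]_n)
    (I : {set 'I_n}) :
  A - B \in unitmx ->
  nondegenerate_mx ((A^T + B^T) *m invmx (A^T - B^T)) ->
  exists M : 'M[R]_(n + n, n), forall w, face I w ->
    M *m (T_mx A B *m w) = w.
Proof.
move=> hAB hQ; set Q := _ *m _ in hQ.
pose DI : 'M[R]_n := diag_mx (\row_i (i \in I)%:R).
pose DJ : 'M[R]_n := diag_mx (\row_i (i \notin I)%:R).
pose N := (DI *m Q - DJ)^T.
have Nu : N \in unitmx.
  by rewrite unitmx_tr -row_free_unit nondegenerate_row_free.
exists (col_mx DI DJ *m invmx N *m invmx (A - B)) => w wI.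
set u := usubmx w; set v := dsubmx w.
have DIE (x : 'cV[R]_n) : DI *m x = \col_i ((i \in I)%:R * x i 0).
  by apply/colP => i; rewrite mul_diag_mx !mxE.
have DJE (x : 'cV[R]_n) : DJ *m x = \col_i ((i \notin I)%:R * x i 0).
  by apply/colP => i; rewrite mul_diag_mx !mxE.
have DIu : DI *m (u + v) = u.
  rewrite DIE; apply/colP => i; rewrite !mxE.
  have := wI i; rewrite -/u -/v !mxE.
  by case: (i \in I) => ->; rewrite ?mul1r ?mul0r ?addr0 ?add0r.
have DJv : DJ *m (u + v) = v.
  rewrite DJE; apply/colP => i; rewrite !mxE.
  have := wI i; rewrite -/u -/v !mxE.
  by case: (i \in I) => ->; rewrite ?mul1r ?mul0r ?addr0 ?add0r.
have QTE : (A - B) *m Q^T = A + B.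
  rewrite /Q -[A^T - B^T]linearB -[A^T + B^T]linearD trmx_mul trmx_inv.
  by rewrite !trmxK mulKVmx.
have NE : N = Q^T *m DI - DJ.
  by rewrite /N linearB /= trmx_mul !tr_diag_mx.
have TE : T_mx A B *m w = (A - B) *m (N *m (u + v)).
  have -> : N *m (u + v) = Q^T *m u - v by rewrite NE mulmxBl -mulmxA DIu DJv.
  rewrite mulmxBr mulmxA QTE.
  by rewrite -[w]vsubmxK /T_mx mul_row_col -mulNmx opprB [- A + B]addrC.
by rewrite TE -!mulmxA mulKmx // mulKmx // mul_col_mx DIu DJv vsubmxK.
Qed.

(** * The complementarity set near a strictly complementary point *)

Lemma C2_complementary (R : realType) (n : nat) (w : 'cV[R]_(n + n))
    (i : 'I_n) :
  C2 R n w -> usubmx w i 0 * dsubmx w i 0 = 0.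
Proof.
case=> u0 v0 uv0; apply/eqP.
have /psumr_eq0P/(_ uv0)/(_ i isT) -> // :
  forall i, true -> 0 <= usubmx w i 0 * dsubmx w i 0.
by move=> j _; rewrite mulr_ge0.
Qed.

Definition u_support (R : realType) (n : nat) (l : 'cV[R]_(n + n)) :
    {set 'I_n} := [set i | 0 < usubmx l i 0]%SET.

(** At each index exactly one component of [l] is positive, and it equals the
    bound imposed on the distance; the same component of [s] is then still
    positive, and complementarity makes the other one vanish. *)
Lemma C2_near_face (R : realType) (n : nat) (l s : 'cV[R]_(n + n)) :
  C2 R n l -> C2 R n s ->
  (forall i, enorm (s - l) < usubmx l i 0 + dsubmx l i 0) ->
  face (u_support l) s.
Proof.
move=> l2 s2 near i; rewrite inE.
have ls j : l j 0 - s j 0 <= enorm (s - l).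
  by have := ler_entry_enorm (s - l) j; rewrite !mxE ler_norml; lra.
have := C2_complementary i l2; have := C2_complementary i s2.
have := near i; case: l2 => /(_ i) + /(_ i) + _; rewrite !mxE => u0 v0 sl.
have := ls (lshift n i); have := ls (rshift n i) => dv du ss ll.
case: ltP => ui.
  have vi : l (rshift n i) 0 = 0 by nra.
  move/eqP: ss; rewrite mulf_eq0 => /orP[]/eqP // us; lra.
have uE : l (lshift n i) 0 = 0 by lra.
move/eqP: ss; rewrite mulf_eq0 => /orP[]/eqP // us; lra.
Qed.

Lemma faceB (R : realType) (n : nat) (I : {set 'I_n}) (w z : 'cV[R]_(n + n)) :
  face I w -> face I z -> face I (w - z).
Proof.
move=> wI zI i; have := wI i; have := zI i; rewrite !mxE.
by case: (i \in I) => -> ->; rewrite subrr.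
Qed.

(** Within a subspace [face I], complementarity is automatic, so that C2
    reduces to sign conditions and becomes convex. *)
Lemma C2_segment (R : realType) (n : nat) (I : {set 'I_n})
    (s l : 'cV[R]_(n + n)) (t : R) :
  C2 R n s -> C2 R n l -> face I s -> face I l -> 0 <= t <= 1 ->
  C2 R n (s + t *: (l - s)).
Proof.
move=> [su sv _] [lu lv _] sI lI /andP[t0 t1]; split.
- by move=> i; have := su i; have := lu i; rewrite !mxE => ? ?; nra.
- by move=> i; have := sv i; have := lv i; rewrite !mxE => ? ?; nra.
- apply: big1 => i _; have := sI i; have := lI i; rewrite !mxE.
  by case: (i \in I) => -> ->; rewrite subrr mulr0 addr0 ?mulr0 ?mul0r.
Qed.

(** * Local contraction and linear convergence *)

(** The gain comes from the projection on C1 alone; for the projection on C2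
    it suffices not to increase the distance to [l]. *)
Lemma alt_proj_contraction (R : realType) (n : nat) (A B : 'M[R]_n)
    (c : 'cV[R]_n) (l : 'cV[R]_(n + n)) :
  A - B \in unitmx ->
  nondegenerate_mx ((A^T + B^T) *m invmx (A^T - B^T)) ->
  C1 A B c l -> C2 R n l ->
  (forall i, 0 < usubmx l i 0 + dsubmx l i 0) ->
  exists delta rho : R, [/\ 0 < delta, 0 < rho < 1 &
    forall x y, enorm (x - l) < delta -> alt_proj (C1 A B c) (C2 R n) x y ->
      enorm (y - l) <= rho * enorm (x - l)].
Proof.
move=> hAB hQ l1 l2 lpos.
have [M MT] := face_left_inverse (u_support l) hAB hQ.
have [K [K0 MK]] := mulmx_bounded (M *m T_mx A B).
pose mu := \big[Num.min/1]_i (usubmx l i 0 + dsubmx l i 0).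
have mu0 : 0 < mu by apply: lt_bigmin.
have mul i : mu <= usubmx l i 0 + dsubmx l i 0 by apply: bigmin_le_cond.
have lI : face (u_support l) l.
  apply: C2_near_face => // i; rewrite subrr; apply: le_lt_trans (lpos i).
  rewrite -sqrtr0 ler_sqrt // big1 // => j _; by rewrite mxE expr0n.
(* K + 2 rather than K, which may be 0 or less than 1: the rate must lie
   strictly between 0 and 1. *)
pose q := 1 - (K + 2)^-1.
have K2 : 0 < (K + 2)^-1 < 1 by rewrite invr_gt0 invf_lt1; lra.
have q01 : 0 < q < 1 by rewrite /q; lra.
exists (mu / 2), (Num.sqrt q); split; first by rewrite divr_gt0.
  have -> : Num.sqrt q < 1 by rewrite -[ltRHS]sqrtr1 ltr_sqrt //; lra.
  by rewrite sqrtr_gt0; lra.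
move=> x y xl [s [s2 smin] [y1 ymin]].
have sI : face (u_support l) s.
  apply: C2_near_face => // i.
  have : enorm (s - l) <= 2 * enorm (x - l).
    (* From |s - x| <= |l - x| and the parallelogram identity. *)
    have := smin _ l2; rewrite !ler_enorm => sxl.
    rewrite -ler_sqr ?nnegrE ?mulr_ge0 ?enorm_ge0 // exprMn !sqr_enorm.
    have -> : s - l = (s - x) + (- 1) *: (l - x).
      by apply/matrixP => i' j; rewrite !mxE; ring.
    have := inner_prod_ge0 ((s - x) + 1 *: (l - x)).
    rewrite !inner_prodDZ -(inner_prodN (x - l)) opprB; lra.
  by have := mul i; lra.
have sx : inner_prod (s - l) (s - l) <= inner_prod (x - l) (x - l).
  have := metric_proj_obtuse (conj s2 smin) (fun t => C2_segment s2 l2 sI lI).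
  by have := inner_prod_ge0 (s - x); lra.
have yl1 t : C1 A B c (y + t *: (l - y)).
  move: y1 l1; rewrite /C1 /= => y1 l1.
  by rewrite mulmxDr -scalemxAr mulmxBr y1 l1 subrr scaler0 addr0.
have ys := metric_proj_obtuse (conj y1 ymin) (fun t _ => yl1 t).
have sK : inner_prod (s - l) (s - l) <= K * inner_prod (y - s) (y - s).
  have -> : s - l = - ((M *m T_mx A B) *m (y - s)); last first.
    by rewrite inner_prodN.
  (* T (s - l) = T (s - y), as y and l are both in C1. *)
  rewrite -[LHS](MT _ (faceB sI lI)) -mulmxA -mulmxN -mulmxN; congr (_ *m _).
  by move: y1 l1; rewrite /C1 /= opprB !mulmxBr => -> ->.
rewrite -ler_sqr ?nnegrE ?mulr_ge0 ?sqrtr_ge0 ?enorm_ge0 //.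
rewrite exprMn !sqr_enorm sqr_sqrtr; last by lra.
have : (K + 2)^-1 * inner_prod (s - l) (s - l) <= inner_prod (y - s) (y - s).
  rewrite ler_pdivrMl; last lra.
  by have := inner_prod_ge0 (y - s); lra.
have : q * inner_prod (s - l) (s - l) <= q * inner_prod (x - l) (x - l).
  by rewrite ler_wpM2l //; lra.
rewrite {1}/q mulrBl mul1r; lra.
Qed.

Lemma contraction_cvg (R : realType) (m : nat) (w : nat -> 'cV[R]_m)
    (l : 'cV[R]_m) (rho : R) :
  0 < rho < 1 -> (forall k, enorm (w k.+1 - l) <= rho * enorm (w k - l)) ->
  w @ \oo --> l.
Proof.
move=> /andP[rho0 rho1] step.
have geo k : `|w k - l| <= geometric (enorm (w 0%N - l)) rho k.
  apply: le_trans (ler_norm_enorm _) _; rewrite /geometric /=.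
  elim: k => [|k IHk]; first by rewrite expr0 mulr1.
  by rewrite exprS mulrCA (le_trans (step k)) // ler_pM2l.
have rho_norm : `|rho| < 1 by rewrite gtr0_norm.
apply/subr_cvg0/norm_cvg0P.
apply: (@squeeze_cvgr _ _ _ _ (cst 0) (geometric (enorm (w 0%N - l)) rho)).
- by apply: nearW => k; rewrite normr_ge0 geo.
- exact: cvg_cst.
- exact: cvg_geometric.
Qed.

Theorem theorem3p17 (R : realType) (n : nat) (A B : 'M[R]_n) (c : 'cV[R]_n)
    (ustar vstar : 'cV[R]_n)
    (hAB : A - B \in unitmx)
    (hw : (C1 A B c `&` C2 R n) (col_mx ustar vstar))
    (hstrict : forall i : 'I_n, (ustar i 0, vstar i 0) <> (0, 0))
    (hQ : nondegenerate_mx ((A^T + B^T) *m invmx (A^T - B^T))) :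
  exists delta : R, 0 < delta /\
    forall w : nat -> 'cV[R]_(n + n),
      enorm (w 0%N - col_mx ustar vstar) < delta ->
      (forall k : nat, alt_proj (C1 A B c) (C2 R n) (w k) (w k.+1)) ->
      converges_linearly w (col_mx ustar vstar).
Proof.
case: hw => l1 l2.
have lpos i : 0 < usubmx (col_mx ustar vstar) i 0 +
                  dsubmx (col_mx ustar vstar) i 0.
  case: l2 => /(_ i) + /(_ i) + _; rewrite col_mxKu col_mxKd => u0 v0.
  rewrite lt0r addr_ge0 // andbT paddr_eq0 //.
  by apply/negP => /andP[/eqP ui /eqP vi]; apply: (hstrict i); rewrite ui vi.
have [delta [rho [delta0 rho01 step]]] :=
  alt_proj_contraction hAB hQ l1 l2 lpos.
exists delta; split => // w w0 wS.
(* The contraction applies at every step, as the ball is never left. *)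
have near k : enorm (w k - col_mx ustar vstar) < delta.
  elim: k => [//|k IHk]; apply: le_lt_trans (step _ _ IHk (wS k)) _.
  have := enorm_ge0 (w k - col_mx ustar vstar).
  by case/andP: rho01 => rho0 rho1; nra.
have contr k := step _ _ (near k) (wS k).
by split; [exact: contraction_cvg rho01 contr | exists rho].
Qed.
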